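(* Let $c$ be a Markoff number. If at least one of the integers $3c+2$ and $3c-2$ is a prime power, $4$ times a prime power, or $8$ times a prime power, then $c$ is unique.
   Context: A Markoff triple is a triple $(a,b,c)$ of positive integers satisfying the Markoff equation $a^2+b^2+c^2=3abc$. A Markoff number is a positive integer that occurs as an element of some Markoff triple. A Markoff number $c$ is called unique if the following holds: whenever $(a,b,c)$ and $(\tilde a,\tilde b,c)$ are Markoff triples with $a\le b\le c$ and $\tilde a\le \tilde b\le c$, one has $a=\tilde a$ and $b=\tilde b$. A prime power is an integer of the form $p^n$ with $p$ prime and $n\ge 1$ an integer. *)

(* Defs.v *)
From mathcomp Require Import all_boot.
Set Implicit Arguments.
Unset Strict Implicit.
Unset Printing Implicit Defensive.

Definition markoff_triple (a b c : nat) : Prop :=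
  [/\ 0 < a, 0 < b, 0 < c & a ^ 2 + b ^ 2 + c ^ 2 = 3 * a * b * c].

Definition markoff_number (m : nat) : Prop :=
  exists a b c : nat, markoff_triple a b c /\ [\/ m = a, m = b | m = c].

Definition markoff_unique (c : nat) : Prop :=
  forall a b a' b' : nat,
    markoff_triple a b c -> a <= b -> b <= c ->
    markoff_triple a' b' c -> a' <= b' -> b' <= c ->
    a = a' /\ b = b'.

Definition prime_power (m : nat) : Prop :=
  exists p n : nat, [/\ prime p, 0 < n & m = p ^ n].

Definition prime_power_or_4_8_multiple (m : nat) : Prop :=
  [\/ prime_power m,
      exists2 q : nat, prime_power q & m = 4 * q
    | exists2 q : nat, prime_power q & m = 8 * q].

(* Main.v *)
Require Import Defs.
From mathcomp Require Import all_boot.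
From mathcomp Require Import zify.

(** Fix c and put N = 3c + 2 or N = 3c - 2.  The Markoff equation rewrites as
    (a + b)^2 + c^2 = ab (3c + 2) and as (b - a)^2 + c^2 = ab (3c - 2), so each
    triple with largest element c provides a square root x of - c^2 modulo N,
    namely its sum a + b or its difference b - a; moreover x determines the
    product ab, hence the triple.  Two things make x unique.

    - Size: c is the larger root of z^2 - 3ab z + (a^2 + b^2), so 3ab <= 2c,
      which bounds x by about 2c/3.  Hence 2 (x + y) < N for any two such roots
      as soon as c > 6 ([markoff_max_bound]).
    - Arithmetic: gcd (N, c) divides 2, so modulo an odd prime power q dividing
      N the only square roots of - c^2 are x and - x ([odd_prime_power_sqrt]).
      The remaining factor 4 or 8 of N is controlled by the parity of x, so that
      N divides 2 (x - y) or 2 (x + y) ([sqrt_inj]).  A power of 2 does not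
      occur as N for c > 6: N would be a multiple of 16, hence c = 2 modulo 4, but
      then 16 does not divide x^2 + c^2 ([dvd8_sqrt]).

    Together these give x = y.  The values c <= 6 are checked by computation. *)

(** * Square roots of - c^2 modulo a prime power *)

(** If p divided both x - y and x + y it would divide 2x, hence x, hence c.  So
    all of p ^ n divides a single factor of x^2 - y^2. *)
Lemma odd_prime_power_sqrt (p n c x y : nat) :
  prime p -> odd p -> coprime p c -> 0 < n -> y <= x ->
  p ^ n %| x ^ 2 + c ^ 2 -> p ^ n %| y ^ 2 + c ^ 2 ->
  p ^ n %| x - y \/ p ^ n %| x + y.
Proof.
move=> pp op cpc n0 le_yx dx dy.
have dprod : p ^ n %| (x - y) * (x + y).
  by rewrite -subn_sqr -(subnDr (c ^ 2)) dvdn_sub.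
case: (boolP (p %| x - y)) => [pxy|npxy]; last first.
  by right; rewrite -(@Gauss_dvdr _ (x - y)) // coprimeXl // prime_coprime.
case: (boolP (p %| x + y)) => [pxy'|npxy']; last first.
  by left; rewrite -(@Gauss_dvdl _ _ (x + y)) // coprimeXl // prime_coprime.
have p2x : p %| 2 * x.
  have -> : 2 * x = (x - y) + (x + y) by clear -le_yx; lia.
  exact: dvdn_add.
have px : p %| x by rewrite -(@Gauss_dvdr _ 2) // coprimen2.
have pc : p %| c ^ 2.
  rewrite -(@dvdn_addr (x ^ 2)) ?dvdn_exp //.
  by apply: dvdn_trans dx; rewrite dvdn_exp.
by move: cpc pc; rewrite prime_coprime // Euclid_dvdX // andbT => /negbTE ->.
Qed.

(** * Behaviour at the prime 2 *)

Lemma dvd4_sqrt (c x : nat) : 2 %| c -> 4 %| x ^ 2 + c ^ 2 -> 2 %| x.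
Proof.
move=> c2 d; have : 2 %| x ^ 2.
  rewrite -(@dvdn_addl (c ^ 2)) ?dvdn_exp //.
  exact: dvdn_trans d.
by rewrite Euclid_dvdX // andbT.
Qed.

(** With c = 2 f, f odd, and x = 2 z, the sum is 4 (z^2 + f^2), and z^2 + f^2 is
    1 or 2 modulo 4. *)
Lemma dvd8_sqrt (c x : nat) :
  c %% 4 = 2 -> 8 %| x ^ 2 + c ^ 2 -> x %% 4 = 2 /\ ~~ (16 %| x ^ 2 + c ^ 2).
Proof.
move=> c4 d.
have x2 : 2 %| x.
  by apply: (@dvd4_sqrt c); [lia | exact: dvdn_trans d].
have [[f ec] [z ex]] : (exists f, c = 4 * f + 2) /\ (exists z, x = 4 * z \/ x = 4 * z + 2).
  by split; [exists (c %/ 4) | exists (x %/ 4)]; lia.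
have [ex0|ex2] := ex.
  have e : x ^ 2 + c ^ 2 = 8 * (2 * z ^ 2 + 2 * f ^ 2 + 2 * f) + 4.
    by rewrite ex0 ec; lia.
  by move: d; rewrite e; lia.
have e : x ^ 2 + c ^ 2 = 16 * (z ^ 2 + z + f ^ 2 + f) + 8.
  by rewrite ex2 ec; lia.
by split; rewrite ?e; lia.
Qed.

(** * Uniqueness of the square root attached to a triple *)

(** The prime 2 can only contribute q = 2 ^ n, in which case N would be a power
    of 2 that is at least 16, hence a multiple of 16. *)
Lemma odd_part_cases (N : nat) :
  16 <= N -> prime_power_or_4_8_multiple N -> ~~ (16 %| N) ->
  exists g p n : nat,
    [/\ g \in [:: 1; 4; 8], prime p, odd p, 0 < n & N = g * p ^ n].
Proof.
move=> N16 H nd.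
have [g [q [gin [p [n [pp n0 ->]]] eN]]] :
    exists g q, [/\ g \in [:: 1; 4; 8], prime_power q & N = g * q].
  case: H => [H|[q H ->]|[q H ->]].
  - by exists 1, N; rewrite mul1n.
  - by exists 4, q.
  - by exists 8, q.
exists g, p, n; split=> //.
case: (even_prime pp) => // p2; case/negP: nd; move: N16; rewrite eN p2.
have [m ->] : exists m, g = 2 ^ m.
  by move: gin; rewrite !inE => /or3P[] /eqP ->; [exists 0 | exists 2 | exists 3].
by rewrite -expnD -[16]/(2 ^ 4) leq_exp2l // => /(dvdn_exp2l 2).
Qed.

(** Any common divisor of N and c divides 2, so [odd_prime_power_sqrt] applies to
    the odd part of N, while the residues of x and y modulo 4 are forced by the
    2-part.  The size hypothesis then leaves x - y = 0 or x + y = 0. *)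
Lemma sqrt_inj (c N x y : nat) :
  N = 3 * c + 2 \/ N + 2 = 3 * c -> 16 <= N ->
  prime_power_or_4_8_multiple N ->
  N %| x ^ 2 + c ^ 2 -> N %| y ^ 2 + c ^ 2 -> 2 * (x + y) < N ->
  x = y.
Proof.
move=> eN N16 H; wlog le_yx : x y / y <= x.
  move=> W dx dy lt; case: (leqP y x) => [|/ltnW] le; first exact: W.
  by symmetry; apply: W => //; rewrite addnC.
move=> dx dy lt.
have nd16 : ~~ (16 %| N).
  apply/negP => d16; have c4 : c %% 4 = 2 by clear -eN d16; lia.
  have dx16 := dvdn_trans d16 dx.
  have [_] := @dvd8_sqrt c x c4 (@dvdn_trans 16 8 _ isT dx16).
  by rewrite dx16.
have [g [p [n [gin pp op n0 eNg]]]] := @odd_part_cases N N16 H nd16.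
have gN : g %| N by rewrite eNg dvdn_mulr.
have qN : p ^ n %| N by rewrite eNg dvdn_mull.
have cpc : coprime p c.
  rewrite prime_coprime //; apply/negP => pc.
  have pN : p %| N by apply: dvdn_trans qN; rewrite -{1}(expn1 p) dvdn_exp2l.
  have p3c : p %| 3 * c by rewrite dvdn_mull.
  have p2 : p %| 2.
    by case: eN => e; [rewrite -(dvdn_addr _ p3c) -e | rewrite -(dvdn_addr _ pN) e].
  by move: op; rewrite (eqP (_ : p == 2)) // -(dvdn_prime2 pp).
(* Parity makes up for the factor g, at the cost of a factor 2. *)
have [gsub gadd] : g %| 2 * (x - y) /\ g %| 2 * (x + y).
  move: gin gN; rewrite !inE => /or3P[] /eqP -> gN; first by rewrite !dvd1n.
    have c2 : 2 %| c by clear -eN gN; lia.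
    have x2 := dvd4_sqrt _ _ c2 (dvdn_trans gN dx).
    have y2 := dvd4_sqrt _ _ c2 (dvdn_trans gN dy).
    by clear -x2 y2; lia.
  have c4 : c %% 4 = 2 by clear -eN gN; lia.
  have [x4 _] := dvd8_sqrt _ _ c4 (dvdn_trans gN dx).
  have [y4 _] := dvd8_sqrt _ _ c4 (dvdn_trans gN dy).
  by clear -x4 y4; lia.
have cgq : coprime g (p ^ n).
  have c2 : coprime 2 p by rewrite coprime2n.
  apply: coprimeXr; move: gin; rewrite !inE => /or3P[] /eqP ->.
  - exact: coprime1n.
  - exact: (coprimeXl 2 c2).
  - exact: (coprimeXl 3 c2).
have Ndvd z : g %| 2 * z -> p ^ n %| z -> 2 * z < N -> z = 0.
  move=> gz qz zN.
  have : N %| 2 * z by rewrite eNg Gauss_dvd // gz dvdn_mull.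
  by case: (posnP z) => // z0 /dvdn_leq; clear -z0 zN; lia.
have := @odd_prime_power_sqrt p n c x y pp op cpc n0 le_yx
  (dvdn_trans qN dx) (dvdn_trans qN dy).
by case=> q; [have := Ndvd _ gsub q | have := Ndvd _ gadd q]; clear -le_yx lt; lia.
Qed.

(** * Markoff triples *)

(** Otherwise the other root c' = 3ab - c of the quadratic would exceed c >= b,
    and (c - b) (c' - b) >= 0 would make c c' larger than a^2 + b^2,
    except that a = b = c = 1 gives equality; whence c > 1. *)
Lemma markoff_max_bound (a b c : nat) :
  markoff_triple a b c -> a <= b -> b <= c -> 1 < c -> 3 * (a * b) <= 2 * c.
Proof.
move=> [a0 b0 c0 e] ab bc c1; rewrite leqNgt; apply/negP => lt.
have [c' ec'] : exists c', 3 * (a * b) = c + c' by exists (3 * (a * b) - c); lia.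
have e' : c * c' = a ^ 2 + b ^ 2 by nia.
have [u eu] : exists u, c = b + u by exists (c - b); lia.
have [v ev] : exists v, c' = b + u + v.+1 by exists (c' - c).-1; lia.
(* This is c c' = (c - b) (c' - b) + b (c + c') - b^2.  It squeezes
   3 b^2 <= 3 a b^2 <= a^2 + 2 b^2 <= 3 b^2 into equalities. *)
have h : b * (3 * (a * b)) + u * (u + v.+1) = a ^ 2 + 2 * b ^ 2.
  by rewrite ec' eu ev; rewrite eu ev in e'; lia.
have h1 : a ^ 2 <= b ^ 2 by rewrite leq_exp2r.
have h2 : b ^ 2 <= b * (a * b) by rewrite expnS expn1 leq_mul2l leq_pmull ?orbT.
have /eqP : u * (u + v.+1) = 0 by clear -h h1 h2; lia.
rewrite muln_eq0 addnS orbF => /eqP u0; rewrite u0 in eu h.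
have /eqP : a ^ 2 = b ^ 2 by clear -h h1 h2; lia.
rewrite eqn_exp2r // => /eqP a_b; rewrite a_b in h.
have : b * (b * b) = b * b by clear -h; lia.
move/eqP; rewrite eqn_pmul2l // -[X in _ == X]muln1 eqn_pmul2l // => /eqP b1.
by move: c1; rewrite eu b1.
Qed.

Lemma markoff_sum (a b c : nat) : markoff_triple a b c ->
  (a + b) ^ 2 + c ^ 2 = a * b * (3 * c + 2).
Proof. by case=> _ _ _; lia. Qed.

Lemma markoff_diff (a b c : nat) : markoff_triple a b c -> a <= b ->
  (b - a) ^ 2 + c ^ 2 = a * b * (3 * c - 2).
Proof.
move=> [a0 _ c0 e] ab; have [d ed] : exists d, b = a + d by exists (b - a); lia.
have [m em] : exists m, 3 * c = m + 2 by exists (3 * c - 2); lia.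
have -> : 3 * c - 2 = m by lia.
have -> : b - a = d by lia.
have : 3 * a * b * c = a * b * (m + 2) by rewrite -em; lia.
by rewrite -e ed; lia.
Qed.

Lemma markoff_unique_small (c : nat) : c <= 6 -> markoff_unique c.
Proof.
move=> c6 a b a' b' [_ b0 c0 e] ab bc [_ b0' _ e'] ab' bc'.
pose ok c a b := (a <= b <= c) && (0 < a) && (a ^ 2 + b ^ 2 + c ^ 2 == 3 * a * b * c).
pose r := iota 0 7.
have chk : all (fun c => all (fun a => all (fun b => all (fun a' => all (fun b' =>
    ok c a b && ok c a' b' ==> (a == a') && (b == b')) r) r) r) r) r.
  by vm_compute.
have inr z : z <= 6 -> z \in r by rewrite mem_iota.
have := allP (allP (allP (allP (allP chk c (inr _ c6)) a _) b _) a' _) b' _.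
by rewrite /ok !inr; lia.
Qed.

(** * Uniqueness *)

Theorem theorem2 (c : nat) (hc : markoff_number c)
  (hpp : prime_power_or_4_8_multiple (3 * c + 2) \/
         prime_power_or_4_8_multiple (3 * c - 2)) :
  markoff_unique c.
Proof.
case: (leqP c 6) => [|c6]; first exact: markoff_unique_small.
move=> a b a' b' T ab bc T' ab' bc'.
have B := @markoff_max_bound _ _ _ T ab bc ltac:(lia).
have B' := @markoff_max_bound _ _ _ T' ab' bc' ltac:(lia).
have [a0 b0 _ _] := T; have [a0' b0' _ _] := T'.
case: hpp => H.
- have E := @markoff_sum _ _ _ T; have E' := @markoff_sum _ _ _ T'.
  have es : a + b = a' + b'.
    apply: (@sqrt_inj c _ _ _ _ _ H); rewrite ?E ?E' ?dvdn_mull //; try lia.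
    (* (a - 1) (b - 1) >= 0 turns the bound on a b into one on a + b. *)
    have : a + b <= a * b + 1 by clear -a0 b0; nia.
    have : a' + b' <= a' * b' + 1 by clear -a0' b0'; nia.
    lia.
  have ep : a * b = a' * b'.
    by apply/eqP; rewrite -(@eqn_pmul2r (3 * c + 2)) -?E -?E' ?es //; lia.
  suff : a = a' by lia.
  by case: (ltngtP a a') => // lt; clear -es ep lt ab ab'; nia.
- have E := @markoff_diff _ _ _ T ab; have E' := @markoff_diff _ _ _ T' ab'.
  have ed : b - a = b' - a'.
    apply: (@sqrt_inj c _ _ _ _ _ H); rewrite ?E ?E' ?dvdn_mull //; try lia.
    have : b <= a * b by exact: leq_pmull.
    have : b' <= a' * b' by exact: leq_pmull.
    lia.
  have ep : a * b = a' * b'.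
    by apply/eqP; rewrite -(@eqn_pmul2r (3 * c - 2)) -?E -?E' ?ed //; lia.
  suff : a = a' by lia.
  by case: (ltngtP a a') => // lt; clear -ed ep lt ab ab' a0 a0'; nia.
Qed.
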